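(* Let $\tau$ be a primitive, aperiodic, segregating substitution whose ll, rl, ls and rs graphs are all subfixed. Then for every left special or right special sequence $x\in X_\tau$ there exists a generator $g$ for $\tau$ such that $g^*\sim_o x$.
   Context: Let $\mathcal{A}$ be a finite nonempty alphabet, $\mathcal{A}^*$ the finite words over $\mathcal{A}$ (including the empty word), $\mathcal{A}^+$ the nonempty words, $|u|$ the length of $u$. A word $u$ is a factor of $v$ if $v=w_1uw_2$ for some words $w_1,w_2$. A substitution is a map $\tau:\mathcal{A}\to\mathcal{A}^+$ extended to a concatenation-respecting map on words and letterwise to sequences. For $x\in\mathcal{A}^{\mathbb{Z}}$, $x_{[i]}$ denotes the letter at index $i$, $x_{[i,j]}$ the word $x_{[i]}\cdots x_{[j]}$, and $x_{[i,\infty[}$ the one-sided sequence $x_{[i]}x_{[i+1]}\cdots$. The language $\mathcal{L}(\tau)$ is the set of words that are factors of $\tau^m(a)$ for some letter $a$ and some $m\ge1$, and $\mathcal{L}_k(\tau)$ denotes its words of length $k$; $X_\tau=\{x\in\mathcal{A}^{\mathbb{Z}}: x_{[i,j]}\in\mathcal{L}(\tau)\ \forall i\le j\}$. $\tau$ is primitive if there is $m\ge1$ such that every letter $b$ is a factor of $\tau^m(a)$ for every letter $a$, and there is a letter $a$ such that for every $N$ there is $m$ with $|\tau^m(a)|>N$; a primitive $\tau$ is aperiodic if $X_\tau$ is infinite. A sequence $x\in X_\tau$ is left special if there is $y\in X_\tau$ with $x_{[-1]}\neq y_{[-1]}$ and $x_{[0,\infty[}=y_{[0,\infty[}$; it is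 right special if there is $y\in X_\tau$ with $x_{[0]}\neq y_{[0]}$ and $x_{[i]}=y_{[i]}$ for all $i\le -1$. For $x,y\in X_\tau$, $x\sim_o y$ means there is $m\in\mathbb{Z}$ with $x_{[i]}=y_{[i+m]}$ for all $i$. A generator for $\tau$ is a triple $(v,u,w)$ with $v,u,w\in\mathcal{A}^+$, $u\in\mathcal{L}(\tau)$ and $\tau(u)=vuw$; its completion $(v,u,w)^*$ is the two-sided sequence $\cdots\tau^2(v)\tau(v)vu.w\tau(w)\tau^2(w)\cdots$, i.e. the left-infinite word $\cdots\tau^2(v)\tau(v)vu$ occupies the negative indices, ending at index $-1$, and the right-infinite word $w\tau(w)\tau^2(w)\cdots$ occupies the indices $\ge0$, starting at index $0$. A positive integer $k$ is a left segregating number for $\tau$ if for any two words $s,t\in\mathcal{L}_k(\tau)$ with different leftmost letters, the length of the longest common prefix of $\tau(s)$ and $\tau(t)$ is at most $\min\{|\tau(s)|,|\tau(t)|\}-k$; right segregating numbers are defined symmetrically using rightmost letters and longest common suffixes. $\tau$ is segregating if it has both a left and a right segregating number. The ll graph (resp. rl graph) is the directed graph on vertex set $\mathcal{A}$ with exactly one edge from each letter $a$ to the leftmost (resp. rightmost) letter of $\tau(a)$. If $n$ is the least left segregating number, the ls graph has as vertices the ordered pairs $(s,t)$ of words in $\mathcal{L}_n(\tau)$ with different leftmost letters, and exactly one edge from $(s,t)$ to $(s',t')$, where $s'$, $t'$ are the first $n$ letters of the words obtained by deleting the longest common prefix from $\tau(s)$ and $\tau(t)$ respectively. If $n$ is the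 least right segregating number, the rs graph has as vertices the ordered pairs $(s,t)$ of words in $\mathcal{L}_n(\tau)$ with different rightmost letters, and exactly one edge from $(s,t)$ to $(s',t')$, where $s'$, $t'$ are the last $n$ letters of the words obtained by deleting the longest common suffix from $\tau(s)$ and $\tau(t)$ respectively. Such a graph (every vertex having exactly one outgoing edge) is subfixed if for every vertex $x$, either the edge leaving $x$ goes to $x$, or it goes to a vertex $y$ whose outgoing edge goes to $y$ itself. *)

(* Defs.v *)
From mathcomp Require Import all_boot all_order all_algebra.
Set Implicit Arguments. Unset Strict Implicit. Unset Printing Implicit Defensive.
Import GRing.Theory Num.Theory.

Section Subst.
Variable A : finType.
Variable tau : A -> seq A.

Definition subst (s : seq A) : seq A := flatten (map tau s).
Definition tpow (k : nat) (s : seq A) : seq A := iter k subst s.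

Definition inL (u : seq A) : Prop :=
  exists (a : A) (m : nat), (1 <= m)%N /\ infix u (tpow m [:: a]).

Definition word_at (x : int -> A) (i : int) (n : nat) : seq A :=
  mkseq (fun k => x (i + k%:Z)%R) n.

Definition inX (x : int -> A) : Prop :=
  forall (i : int) (n : nat), inL (word_at x i n).

Definition primitive : Prop :=
  (exists m : nat, (1 <= m)%N /\ forall a b : A, b \in tpow m [:: a]) /\
  (exists a : A, forall N : nat, exists m : nat, (N < size (tpow m [:: a]))%N).

(* X_tau is infinite: not covered by finitely many sequences *)
Definition aperiodic : Prop :=
  ~ exists (n : nat) (f : 'I_n -> int -> A), forall x, inX x -> exists i, x = f i.

Definition left_special (x : int -> A) : Prop :=
  exists y, inX y /\ x (-1)%R <> y (-1)%R /\ forall i : int, (0 <= i)%R -> x i = y i.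

Definition right_special (x : int -> A) : Prop :=
  exists y, inX y /\ x 0%R <> y 0%R /\ forall i : int, (i <= -1)%R -> x i = y i.

Definition shift_equiv (x y : int -> A) : Prop :=
  exists m : int, forall i : int, x i = y (i + m)%R.

Definition is_generator (v u w : seq A) : Prop :=
  v != [::] /\ u != [::] /\ w != [::] /\ inL u /\ subst u = v ++ u ++ w.

Definition right_word (w : seq A) (k : nat) : seq A :=
  flatten [seq tpow i w | i <- iota 0 k.+1].
Definition left_word (v u : seq A) (k : nat) : seq A :=
  flatten [seq tpow (k - i) v | i <- iota 0 k.+1] ++ u.

(* completion (v,u,w)^* ; d is an (irrelevant) default letter for nth,
   all accessed indices are in range *)
Definition completion (d : A) (v u w : seq A) (i : int) : A :=
  match i with
  | Posz n => nth d (right_word w n) n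
  | Negz n => nth d (left_word v u n) (size (left_word v u n) - n.+1)
  end.

Fixpoint lcp (s t : seq A) : nat :=
  match s, t with
  | a :: s', b :: t' => if a == b then (lcp s' t').+1 else 0
  | _, _ => 0
  end.
Definition lcs (s t : seq A) : nat := lcp (rev s) (rev t).

Definition diff_first (s t : seq A) : Prop :=
  match s, t with
  | a :: _, b :: _ => a <> b
  | _, _ => False
  end.
Definition diff_last (s t : seq A) : Prop := diff_first (rev s) (rev t).

Definition inLn (n : nat) (s : seq A) : Prop := inL s /\ size s = n.

Definition left_seg (k : nat) : Prop :=
  (0 < k)%N /\ forall s t, inLn k s -> inLn k t -> diff_first s t ->
    (lcp (subst s) (subst t) + k <= minn (size (subst s)) (size (subst t)))%N.

Definition right_seg (k : nat) : Prop :=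
  (0 < k)%N /\ forall s t, inLn k s -> inLn k t -> diff_last s t ->
    (lcs (subst s) (subst t) + k <= minn (size (subst s)) (size (subst t)))%N.

Definition segregating : Prop := (exists k, left_seg k) /\ (exists k, right_seg k).

Definition least_left_seg (n : nat) : Prop :=
  left_seg n /\ forall k, left_seg k -> (n <= k)%N.
Definition least_right_seg (n : nat) : Prop :=
  right_seg n /\ forall k, right_seg k -> (n <= k)%N.

Definition ll_edge (a : A) : A := head a (tau a).
Definition rl_edge (a : A) : A := last a (tau a).

Definition subfixed_fun (T : Type) (V : T -> Prop) (e : T -> T) : Prop :=
  forall x, V x -> e x = x \/ e (e x) = e x.

Definition ll_subfixed : Prop := subfixed_fun (fun _ => True) ll_edge.
Definition rl_subfixed : Prop := subfixed_fun (fun _ => True) rl_edge.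

Definition ls_vertex (n : nat) (p : seq A * seq A) : Prop :=
  inLn n p.1 /\ inLn n p.2 /\ diff_first p.1 p.2.
Definition rs_vertex (n : nat) (p : seq A * seq A) : Prop :=
  inLn n p.1 /\ inLn n p.2 /\ diff_last p.1 p.2.

Definition ls_edge (n : nat) (p : seq A * seq A) : seq A * seq A :=
  let s := subst p.1 in let t := subst p.2 in let q := lcp s t in
  (take n (drop q s), take n (drop q t)).

Definition rs_edge (n : nat) (p : seq A * seq A) : seq A * seq A :=
  let s := subst p.1 in let t := subst p.2 in let q := lcs s t in
  let s' := take (size s - q) s in let t' := take (size t - q) t in
  (drop (size s' - n) s', drop (size t' - n) t').

Definition ls_subfixed : Prop :=
  forall n, least_left_seg n -> subfixed_fun (ls_vertex n) (ls_edge n).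
Definition rs_subfixed : Prop :=
  forall n, least_right_seg n -> subfixed_fun (rs_vertex n) (rs_edge n).

End Subst.

(* Main.v *)
Require Import Defs.
From mathcomp Require Import all_boot all_order all_algebra.
From mathcomp Require Import boolp zify.
Set Implicit Arguments. Unset Strict Implicit. Unset Printing Implicit Defensive.

(* Call (x, y) asymptotic when x and y agree on [0, oo) and differ at -1; these
   are the left special sequences with a witness, and right special ones reduce
   to them by reversing all words.

   The key point is that every asymptotic pair is, up to a shift, the image under
   tau of an asymptotic pair. Let k be maximal such that every word of the
   language has k parses into blocks tau(a) with pairwise disjoint cutting points.
   By compactness x and y have k such parses each, and by maximality and
   recurrence a parse of x and a parse of y share a cutting point on the common
   tail. A left segregating number then forces the two desubstitutions to agree to
   the right of that point, and the place where they first differ on the left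
   gives the asymptotic pair (x', y').

   The last n letters of (x, y) before the splitting point, n the least right
   segregating number, are the rs-successor of those of (x', y'). As every
   asymptotic pair has a preimage, all these vertices are fixed by the rs graph,
   and the ll and rl graphs likewise fix the two letters next to them. Hence the
   word u = x[-n-1, 0] is the same for x and x', tau(u) = v u w, and iterating the
   desubstitution exhibits x as the completion of (v, u, w). *)

(** * Compactness of sequences over a finite alphabet *)

Section Compactness.
Variable B : finType.

(** König's lemma: a finite prefix shared by [f n] for arbitrarily large [n] has, by pigeonhole over
    the finite [B], a one-letter extension with the same property. The limit [g] is the union of the
    prefixes so chosen. *)
Lemma nat_fun_compact (b0 : B) (f : nat -> nat -> B) :
  exists g : nat -> B, forall N, exists2 n, N <= n & forall i, i < N -> g i = f n i.
Proof.
pose good s := forall M, exists2 n, M <= n &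
  forall i, i < size s -> nth b0 s i = f n i.
have ext s : good s -> exists b, good (rcons s b).
  move=> gs; apply: contrapT => /forallNP nb.
  have /choice[M HM] : forall b, exists M, forall n, M <= n ->
      exists2 i, i < (size s).+1 & nth b0 (rcons s b) i <> f n i.
    move=> b; have /existsNP[M HM] := nb b; exists M => n Mn.
    apply: contrapT => H; apply: HM; exists n => // i; rewrite size_rcons => li.
    by apply: contrapT => ne; apply: H; exists i.
  (* Beyond all thresholds [M b], the letter that [f n] itself puts next contradicts its own
     threshold. *)
  have [n nM Hn] := gs (\max_b M b).
  have [|i li] := HM (f n (size s)) n.
    by apply: leq_trans nM; rewrite (leq_bigmax (F := M)).
  move: li; rewrite ltnS leq_eqVlt nth_rcons => /orP[/eqP->|li].
    by rewrite ltnn eqxx.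
  by rewrite li Hn.
have g0 : good [::] by move=> M; exists M.
have /choice[nx Hnx] : forall s, exists b, good s -> good (rcons s b).
  move=> s; have [/ext[b gb]|ng] := pselect (good s); first by exists b.
  by exists b0.
pose t := fix t n := if n is n'.+1 then rcons (t n') (nx (t n')) else [::].
have gt n : good (t n) by elim: n => //= n /Hnx.
have st n : size (t n) = n by elim: n => //= n IH; rewrite size_rcons IH.
have tt i n : i < n -> nth b0 (t n) i = nx (t i).
  elim: n => // n IH; rewrite ltnS leq_eqVlt => /orP[/eqP->|li] /=.
    by rewrite nth_rcons st ltnn eqxx.
  by rewrite nth_rcons st li IH.
exists (fun i => nx (t i)) => N; have [n Nn Hn] := gt N N.
by exists n => // i iN; rewrite -(tt _ _ iN) Hn // st.
Qed.

Lemma fun_compact (b0 : B) (I : countType) (f : nat -> I -> B) :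
  exists g : I -> B, forall (s : seq I) N,
    exists2 n, N <= n & {in s, forall i, g i = f n i}.
Proof.
have [g Hg] := nat_fun_compact b0
  (fun n j => if unpickle j is Some i then f n i else b0).
exists (g \o pickle) => s N.
have [n nN Hn] := Hg (maxn N (\max_(i <- s) (pickle i).+1)).
exists n => [|i si /=]; first by apply: leq_trans nN; rewrite leq_maxl.
by rewrite Hn ?pickleK // leq_max (leq_bigmax_seq (F := fun i => (pickle i).+1)) ?orbT.
Qed.

End Compactness.

(** * Windows of two-sided sequences *)

Section Words.
Variable B : finType.
Implicit Types (x y : int -> B) (i j : int).

Lemma size_word_at x i n : size (word_at x i n) = n.
Proof. by rewrite size_mkseq. Qed.

Lemma nth_word_at b x i n k : k < n -> nth b (word_at x i n) k = x (i + k%:Z)%R.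
Proof. by move=> kn; rewrite nth_mkseq. Qed.

Lemma eq_word_at x y i j n :
  (forall k, k < n -> x (i + k%:Z)%R = y (j + k%:Z)%R) -> word_at x i n = word_at y j n.
Proof.
move=> H; apply: (@eq_from_nth _ (x i)); rewrite !size_word_at // => k kn.
by rewrite !nth_word_at // H.
Qed.

Lemma word_at_eq x y i j n k :
  word_at x i n = word_at y j n -> k < n -> x (i + k%:Z)%R = y (j + k%:Z)%R.
Proof. by move=> E kn; rewrite -(nth_word_at (x i) x i kn) E nth_word_at. Qed.

Lemma word_at_cat x i m n :
  word_at x i (m + n) = word_at x i m ++ word_at x (i + m%:Z)%R n.
Proof.
apply: (@eq_from_nth _ (x i)); rewrite ?size_cat !size_word_at // => k kn.
rewrite nth_cat size_word_at nth_word_at //; case: ltnP => km.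
  by rewrite nth_word_at.
by rewrite nth_word_at; [congr x|]; lia.
Qed.

Lemma word_at1 x i : word_at x i 1 = [:: x i].
Proof. by rewrite /word_at /mkseq /= GRing.addr0. Qed.

Lemma word_atS x i n : word_at x i n.+1 = x i :: word_at x (i + 1)%R n.
Proof. by rewrite -add1n word_at_cat word_at1. Qed.

Lemma word_atSr x i n : word_at x i n.+1 = rcons (word_at x i n) (x (i + n%:Z)%R).
Proof. by rewrite -addn1 word_at_cat word_at1 cats1. Qed.

Lemma word_at_sub x i l m r :
  word_at x i (size (l ++ m ++ r)) = l ++ m ++ r ->
  word_at x (i + (size l)%:Z)%R (size m) = m.
Proof.
rewrite !size_cat word_at_cat => /eqP; rewrite eqseq_cat ?size_word_at //.
case/andP=> _; rewrite word_at_cat eqseq_cat ?size_word_at //.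
by case/andP=> /eqP.
Qed.

Lemma word_at_subwin x i n j m :
  (i <= j)%R -> (j + m%:Z <= i + n%:Z)%R ->
  exists l r, word_at x i n = l ++ word_at x j m ++ r /\ size l = absz (j - i)%R.
Proof.
move=> ij jn; exists (word_at x i (absz (j - i)%R)).
exists (word_at x (j + m%:Z)%R (absz (i + n%:Z - j - m%:Z)%R)).
rewrite size_word_at; split=> //.
have -> : n = absz (j - i)%R + (m + absz (i + n%:Z - j - m%:Z)%R) by lia.
rewrite word_at_cat word_at_cat; congr (_ ++ (word_at _ _ _ ++ word_at _ _ _)); lia.
Qed.

Lemma infix_word_at x i n j m :
  (i <= j)%R -> (j + m%:Z <= i + n%:Z)%R -> infix (word_at x j m) (word_at x i n).
Proof.
by move=> ij jn; have [l [r [-> _]]] := word_at_subwin x ij jn; apply/infixP; exists l, r.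
Qed.

Lemma word_at_infixP x i n u : infix u (word_at x i n) ->
  exists p, p + size u <= n /\ word_at x (i + p%:Z)%R (size u) = u.
Proof.
case/infixP=> l [r E]; exists (size l); have Es := congr1 size E.
rewrite size_word_at !size_cat in Es; split; first by lia.
by apply: (@word_at_sub x i l u r); rewrite -E size_word_at.
Qed.

End Words.

(** * Longest common prefixes and suffixes *)

Section Lcp.
Variable A : finType.
Implicit Types s t r : seq A.

Lemma lcp_cat r s t : lcp (r ++ s) (r ++ t) = size r + lcp s t.
Proof. by elim: r => //= a r ->; rewrite eqxx. Qed.

Lemma lcp_diff r s t : diff_first s t -> lcp (r ++ s) (r ++ t) = size r.
Proof.
rewrite lcp_cat; case: s t => [|a s] [|b t] //= /eqP/negbTE->; exact: addn0.
Qed.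

Lemma lcp_prefix s t : lcp s (s ++ t) = size s.
Proof. by rewrite -{1}[s]cats0 lcp_cat addn0. Qed.

Lemma lcpC s t : lcp s t = lcp t s.
Proof. by elim: s t => [|a s IH] [|b t] //=; rewrite eq_sym IH. Qed.

Lemma lcp_word_at (x : int -> A) i m n :
  lcp (word_at x i m) (word_at x i n) = minn m n.
Proof.
wlog mn : m n / m <= n.
  by case/orP: (leq_total m n) => mn H; last rewrite lcpC minnC; apply: H.
by rewrite -(subnKC mn) word_at_cat lcp_prefix size_word_at subnKC //; lia.
Qed.

Lemma lcs_diff r s t : diff_last s t -> lcs (s ++ r) (t ++ r) = size r.
Proof. by move=> d; rewrite /lcs !rev_cat lcp_diff ?size_rev. Qed.

Lemma lcs_word_at (x : int -> A) (j : int) m n :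
  lcs (word_at x (j - m%:Z)%R m) (word_at x (j - n%:Z)%R n) = minn m n.
Proof.
wlog mn : m n / m <= n.
  by case/orP: (leq_total m n) => mn H; last rewrite /lcs lcpC minnC; apply: H.
have -> : word_at x (j - n%:Z)%R n =
    word_at x (j - n%:Z)%R (n - m) ++ word_at x (j - m%:Z)%R m.
  rewrite -{2}(subnK mn) word_at_cat; congr (_ ++ word_at _ _ _); lia.
by rewrite /lcs rev_cat lcp_prefix size_rev size_word_at; lia.
Qed.

End Lcp.

(** * Substitutions and their blocks *)

Section Substitution.
Variable A : finType.
Implicit Types (tau : A -> seq A) (s t u v w : seq A) (a b : A).

Lemma subst_cat tau s t : subst tau (s ++ t) = subst tau s ++ subst tau t.
Proof. by rewrite /subst map_cat flatten_cat. Qed.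

Lemma subst_cons tau a s : subst tau (a :: s) = tau a ++ subst tau s.
Proof. by []. Qed.

Lemma subst1 tau a : subst tau [:: a] = tau a.
Proof. exact: cats0. Qed.

Lemma tpowS tau k s : tpow tau k.+1 s = subst tau (tpow tau k s).
Proof. by []. Qed.

Lemma tpowD tau m n s : tpow tau (m + n) s = tpow tau m (tpow tau n s).
Proof. exact: iterD. Qed.

Lemma tpow_cat tau k s t : tpow tau k (s ++ t) = tpow tau k s ++ tpow tau k t.
Proof. by elim: k => // k IH; rewrite !tpowS IH subst_cat. Qed.

(* [infixP] with the carrier type kept as [Finite.sort A], so that [lia]
   identifies the sizes it produces with the others. *)
Lemma infix_catP (B : finType) (s t : seq B) :
  infix s t -> exists l r : seq B, t = l ++ s ++ r.
Proof. by case/infixP=> l [r ->]; exists l, r. Qed.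

Lemma infix_subst tau s t : infix s t -> infix (subst tau s) (subst tau t).
Proof.
by case/infixP=> l [r ->]; apply/infixP; exists (subst tau l), (subst tau r); rewrite !subst_cat.
Qed.

Lemma infix_tpow tau k s t : infix s t -> infix (tpow tau k s) (tpow tau k t).
Proof. by elim: k => // k IH /IH; apply: infix_subst. Qed.

Lemma subst_tpow tau k s : subst (fun a => tpow tau k [:: a]) s = tpow tau k s.
Proof.
elim: s => [|a s IH]; first by elim: k => // k; rewrite tpowS => <-.
by rewrite subst_cons IH -tpow_cat.
Qed.

Lemma size_subst_le tau s : size (subst tau s) <= (\max_a size (tau a)) * size s.
Proof.
elim: s => [|a s IH]; first by rewrite muln0.
by rewrite subst_cons size_cat mulnS leq_add // (leq_bigmax (F := fun a => size (tau a))).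
Qed.

Lemma block_at tau w i : i < size (subst tau w) ->
  exists w1 b w2, w = w1 ++ b :: w2 /\
    size (subst tau w1) <= i < size (subst tau w1) + size (tau b).
Proof.
elim: w i => // a w IH i; rewrite subst_cons size_cat.
case: (ltnP i (size (tau a))) => ia; first by exists [::], a, w.
move=> ltiw; have /IH[w1 [b [w2 [-> Hi]]]] : i - size (tau a) < size (subst tau w) by lia.
by exists (a :: w1), b, w2; rewrite cat_cons subst_cons size_cat; split=> //; lia.
Qed.

Lemma infix_mem a s : a \in s -> infix [:: a] s.
Proof. by case/splitPr=> p1 p2; apply/infixP; exists p1, p2. Qed.

(** With [S] the maximal block length, the block covering index [S - 1] of [v] starts no earlier
    than [v] and ends within its first [2S - 1] letters. *)
Lemma infix_block tau w v : infix v (subst tau w) ->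
  (\max_a size (tau a)).*2 <= size v -> v != [::] -> exists b, infix (tau b) v.
Proof.
set S := \max_a _ => /infix_catP[p [q E]] Sv v0.
have := congr1 size E; rewrite !size_cat => Es.
have ltw : size p + S.-1 < size (subst tau w).
  by rewrite Es; clear -Sv v0; clearbody S; case: v v0 Sv => //= b v _ Sv; lia.
have [w1 [b [w2 [Ew Hi]]]] := block_at ltw.
have bS : size (tau b) <= S by rewrite (leq_bigmax (F := fun a => size (tau a))).
exists b; rewrite Ew subst_cat subst_cons in E.
have Ev : v = take (size v) (drop (size p) (p ++ v ++ q)).
  by rewrite drop_size_cat // take_size_cat.
rewrite {}Ev (_ : drop (size p) (p ++ v ++ q) =
    drop (size p) (subst tau w1) ++ tau b ++ subst tau w2); last first.
  rewrite -E drop_cat; case: ltnP => // le1.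
  rewrite (_ : size p - size (subst tau w1) = 0) ?drop0; last by lia.
  by rewrite drop_oversize.
rewrite !take_cat size_drop ifN; last by lia.
rewrite ifN; last by lia.
by apply/infixP; exists (drop (size p) (subst tau w1)); eexists.
Qed.

End Substitution.

(** * The language of a primitive substitution *)

Section Language.
Variables (A : finType) (tau : A -> seq A).
Hypothesis Htau : forall a, tau a != [::].
Hypothesis Hprim : primitive tau.
Implicit Types (s t u v w : seq A) (a b : A).

Lemma size_tau_gt0 a : 0 < size (tau a).
Proof. by rewrite lt0n size_eq0. Qed.

Lemma size_subst_ge s : size s <= size (subst tau s).
Proof.
by elim: s => // a s IH; rewrite subst_cons size_cat; have := size_tau_gt0 a => /=; lia.
Qed.

Lemma maxlen_gt0 a : 0 < \max_a size (tau a).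
Proof.
by apply: leq_trans (size_tau_gt0 a) _; rewrite (leq_bigmax (F := fun a => size (tau a))).
Qed.

Lemma inL_infix u v : infix v u -> inL tau u -> inL tau v.
Proof.
by move=> vu [a [m [m1 um]]]; exists a, m; split=> //; apply: infix_trans vu um.
Qed.

(** By primitivity [a] occurs in [tau^p(a)], so an exponent can always be raised by [p]. *)
Lemma inL_large u K : inL tau u ->
  exists a m, K <= m /\ infix u (tpow tau m [:: a]).
Proof.
move=> [a [m [_ um]]]; have [[p [p1 Hp]] _] := Hprim; exists a.
elim: K => [|K [n [Kn un]]]; first by exists m.
exists (n + p); split; first by lia.
by rewrite tpowD; apply: infix_trans un (infix_tpow _ _ (infix_mem (Hp a a))).
Qed.

Lemma inL_desub u : inL tau u -> exists2 t, inL tau t & infix u (subst tau t).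
Proof.
move=> uL; have [a [m [m2 um]]] := inL_large 2 uL.
case: m m2 um => [|[|m]] // _ um.
by exists (tpow tau m.+1 [:: a]) => //; exists a, m.+1; rewrite infix_refl.
Qed.

Lemma inL_long N : exists2 u, inL tau u & size u = N.
Proof.
have [_ [a Ha]] := Hprim; have [m Hm] := Ha N.
exists (take N (tpow tau m.+1 [:: a])).
  by exists a, m.+1; split=> //; apply: prefixW; apply: prefix_take.
rewrite size_takel //; apply: ltnW (leq_trans Hm _).
by rewrite tpowS size_subst_ge.
Qed.

(** Uniform recurrence. For a suitable [K] every block of [theta = tau^K] contains [u], and a word
    longer than twice the largest such block contains a whole one. *)
Lemma inL_recurrent u : inL tau u ->
  exists N, forall v, inL tau v -> N <= size v -> infix u v.
Proof.
move=> [a [m [m1 um]]]; have [[p [p1 Hp]] _] := Hprim.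
pose K := m + p; pose theta b := tpow tau K [:: b].
have uth b : infix u (theta b).
  apply: infix_trans um _; rewrite /theta tpowD.
  exact: infix_tpow (infix_mem (Hp _ _)).
exists ((\max_b size (theta b)).*2.+1) => v vL sv.
have [c [M [KM vM]]] := inL_large K vL.
rewrite -(subnKC KM) tpowD -subst_tpow in vM.
have [||b tb] := infix_block vM; first by apply: ltnW.
  by case: v sv {vL vM}.
exact: infix_trans (uth b) tb.
Qed.

(** A fixed letter would, by primitivity, be the only letter, and its iterates would never grow.
    This later makes [v] and [w] nonempty. *)
Lemma tau_neq_letter a : tau a <> [:: a].
Proof.
move=> E; have Ek k : tpow tau k [:: a] = [:: a].
  by elim: k => // k IH; rewrite tpowS IH subst1.
have [[m [_ Hm]] [b Hb]] := Hprim.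
have all_a c : c = a by have := Hm a c; rewrite Ek inE => /eqP.
by have [k] := Hb 1; rewrite (all_a b) Ek.
Qed.

End Language.

(** * Parses into blocks with disjoint cuts *)

Section Lifts.
Variables (A : finType) (tau : A -> seq A).
Hypothesis Htau : forall a, tau a != [::].
Hypothesis Hprim : primitive tau.
Implicit Types (u v : seq A) (a b : A) (w : seq (A * option A)).
Local Notation S := (\max_a size (tau a)).

(* A lift of a word records a parse of it into (truncated) blocks [tau a]: a
   position carries [Some a] where a block [tau a] starts, and [None] elsewhere. *)
Definition lift_letter a : seq (A * option A) :=
  zip (tau a) (Some a :: nseq (size (tau a)).-1 None).

Definition lift_word u : seq (A * option A) := flatten (map lift_letter u).

Definition inLift w : Prop := exists2 u, inL tau u & infix w (lift_word u).

Definition cut_at w i : option A := nth None (map snd w) i.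

Definition disjoint_cuts w w' : Prop := forall i, cut_at w i = None \/ cut_at w' i = None.

Lemma infix_lift_catP w (w' : seq (A * option A)) :
  infix w w' -> exists l r : seq (A * option A), w' = l ++ w ++ r.
Proof. by case/infixP=> l [r ->]; exists l, r. Qed.

Lemma unzip_lift_letter a :
  map fst (lift_letter a) = tau a /\
  map snd (lift_letter a) = Some a :: nseq (size (tau a)).-1 None.
Proof.
have h : size (tau a) = size (Some a :: nseq (size (tau a)).-1 None).
  by rewrite /= size_nseq prednK ?size_tau_gt0.
by split; [apply: unzip1_zip | apply: unzip2_zip]; rewrite -h.
Qed.

Lemma lift_cat u v : lift_word (u ++ v) = lift_word u ++ lift_word v.
Proof. by rewrite /lift_word map_cat flatten_cat. Qed.

Lemma lift_fst u : map fst (lift_word u) = subst tau u.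
Proof.
elim: u => // a u IH.
by rewrite -[lift_word _]/(lift_letter a ++ lift_word u) map_cat IH (unzip_lift_letter a).1.
Qed.

Lemma size_lift u : size (lift_word u) = size (subst tau u).
Proof. by rewrite -lift_fst size_map. Qed.

Lemma cut_at_lift u1 a u2 : cut_at (lift_word (u1 ++ a :: u2)) (size (subst tau u1)) = Some a.
Proof.
rewrite /cut_at lift_cat map_cat nth_cat size_map size_lift ltnn subnn.
by rewrite -[lift_word (_ :: _)]/(lift_letter a ++ lift_word u2) map_cat (unzip_lift_letter a).2.
Qed.

Lemma cut_at_liftP u i : cut_at (lift_word u) i <> None ->
  exists u1 u2, u = u1 ++ u2 /\ size (subst tau u1) = i.
Proof.
rewrite /cut_at; elim: u i => [|a u IH] i; first by rewrite nth_nil.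
rewrite -[lift_word (_ :: _)]/(lift_letter a ++ lift_word u) map_cat nth_cat.
rewrite (unzip_lift_letter a).2 /= size_nseq prednK ?size_tau_gt0 //.
case: ltnP => ia; first by case: i ia => [|i] ia /=; [exists [::], (a :: u)|rewrite nth_nseq if_same].
case/IH=> u1 [u2 [-> E]]; exists (a :: u1), u2; rewrite subst_cons size_cat E.
by split=> //; lia.
Qed.

Lemma cut_at_infix l w r i : i < size w -> cut_at (l ++ w ++ r) (size l + i) = cut_at w i.
Proof.
move=> iw; rewrite /cut_at !map_cat nth_cat size_map ifN -?leqNgt ?leq_addr //.
by rewrite addKn nth_cat size_map iw.
Qed.

Lemma cut_at_oversize w i : size w <= i -> cut_at w i = None.
Proof. by move=> wi; rewrite /cut_at nth_default ?size_map. Qed.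

Lemma inLift_infix w w' : infix w' w -> inLift w -> inLift w'.
Proof. by move=> h [u uL uw]; exists u => //; apply: infix_trans h uw. Qed.

(** The block covering index [S - 1] has length at most [S], so it starts inside the window. *)
Lemma inLift_cut w : inLift w -> S <= size w -> 0 < S ->
  exists2 i, i < S & cut_at w i <> None.
Proof.
move=> [u uL /infix_lift_catP[l [r E]]] Sw S0.
have := congr1 size E; rewrite size_lift !size_cat => Es.
have lt : size l + S.-1 < size (subst tau u) by lia.
have [w1 [b [w2 [Eu Hi]]]] := block_at lt.
have bS : size (tau b) <= S by rewrite (leq_bigmax (F := fun a => size (tau a))).
exists (size (subst tau w1) - size l); first by lia.
rewrite -(cut_at_infix l r); last by lia.
by rewrite -E Eu subnKC ?cut_at_lift //; lia.
Qed.

Lemma inL_lift u : inL tau u -> exists2 w, inLift w & map fst w = u.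
Proof.
case/(inL_desub Hprim) => t tL /infix_catP[l [r E]].
exists (take (size u) (drop (size l) (lift_word t))).
  exists t => //; apply: infix_trans (prefixW (prefix_take _ _)) _.
  by apply: suffixW; rewrite -{2}(cat_take_drop (size l) (lift_word t)) suffix_suffix.
by rewrite map_take map_drop lift_fst E drop_size_cat // take_size_cat.
Qed.

Definition multi_lift k u : Prop := exists W : nat -> seq (A * option A),
  (forall c, c < k -> inLift (W c) /\ map fst (W c) = u) /\
  (forall c c', c < c' -> c' < k -> disjoint_cuts (W c) (W c')).

Lemma multi_lift1 u : inL tau u -> multi_lift 1 u.
Proof.
by case/inL_lift=> w wL wu; exists (fun=> w); split=> // c [|c'] //; rewrite ltnS ltn0.
Qed.

(** Each lift has a cut among the [S] positions of [u], and disjointness makes a choice of such cuts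
    injective. *)
Lemma multi_lift_bound k u : inL tau u -> size u = S -> 0 < S -> multi_lift k u -> k <= S.
Proof.
move=> uL uS S0 [W [HW dW]].
have /choice[p Hp] : forall c : 'I_k, exists i : 'I_S, cut_at (W c) i <> None.
  move=> c; have [wL wu] := HW c (ltn_ord c).
  have [||i iS Hi] := inLift_cut wL; rewrite -?uS -?wu ?size_map //.
    by rewrite -(size_map fst) wu uS.
  by rewrite -(size_map fst) wu uS in iS *; exists (Ordinal iS).
rewrite -[k]card_ord -[S]card_ord; apply: (leq_card p) => c c' E.
apply: val_inj; case: (ltngtP (val c) (val c')) => // lt.
  by case: (dW _ _ lt (ltn_ord _) (p c)) => N; [case: (Hp c) | case: (Hp c'); rewrite -E].
by case: (dW _ _ lt (ltn_ord _) (p c)) => N; [case: (Hp c'); rewrite -E | case: (Hp c)].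
Qed.

Lemma max_multi_lift : exists k, [/\ 0 < k, forall u, inL tau u -> multi_lift k u &
  exists2 u0, inL tau u0 & ~ multi_lift k.+1 u0].
Proof.
apply: contrapT => H.
have all k : 0 < k -> forall u, inL tau u -> multi_lift k u.
  elim: k => // -[|k] IH _; first exact: multi_lift1.
  move=> u uL; apply: contrapT => nu; apply: H; exists k.+1; split=> //.
    exact: IH.
  by exists u.
have [_ [a _]] := Hprim; have S0 := maxlen_gt0 Htau a.
have [u uL uS] := inL_long Htau Hprim S.
by have := multi_lift_bound uL uS S0 (all S.+1 isT u uL); rewrite ltnn.
Qed.

End Lifts.

(** * Desubstitution of two-sided sequences *)

Section Desubstitution.
Variables (A : finType) (tau : A -> seq A).
Hypothesis Htau : forall a, tau a != [::].
Hypothesis Hprim : primitive tau.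
Implicit Types (x y : int -> A) (F G : int -> A * option A).
Local Notation S := (\max_a size (tau a)).

Definition is_lift F x : Prop :=
  (forall i n, inLift tau (word_at F i n)) /\ forall i, (F i).1 = x i.

Lemma cut_atE (d : A) w i : cut_at w i = (nth (d, None) w i).2.
Proof.
case: (ltnP i (size w)) => iw; first by rewrite /cut_at (nth_map (d, None)).
by rewrite cut_at_oversize // nth_default.
Qed.

Lemma cut_at_word_at F i n k : k < n -> cut_at (word_at F i n) k = (F (i + k%:Z)%R).2.
Proof. by move=> kn; rewrite (cut_atE (F i).1) nth_word_at. Qed.

Lemma fst_word_at F x i n : is_lift F x -> map fst (word_at F i n) = word_at x i n.
Proof. by case=> _ H; rewrite /word_at /mkseq -map_comp; apply: eq_map => k /=. Qed.

(** Compactness applied to lifts of the windows [[-N, N)], with all [k] lifts indexed together so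
    that one limit keeps the cuts disjoint. *)
Lemma multi_lift_seq k x : inX tau x ->
  (forall u, inL tau u -> multi_lift tau k u) ->
  exists F : nat -> int -> A * option A,
    (forall c, c < k -> is_lift (F c) x) /\
    (forall c c', c < c' -> c' < k -> forall i, (F c i).2 = None \/ (F c' i).2 = None).
Proof.
move=> xX Hk.
have /choice[W HW] N := Hk _ (xX (- N%:Z)%R (N + N)).
pose d := (x 0%R, @None A).
pose f N (p : nat * int) := nth d (W N p.1) (absz (p.2 + N%:Z)%R).
have [g Hg] := fun_compact d f.
have sW N c : c < k -> size (W N c) = N + N.
  by move=> /(HW N).1[_ E]; rewrite -(size_map fst) E size_word_at.
exists (fun c i => g (c, i)); split; last first.
  move=> c c' cc' c'k i; have [N _ HN] := Hg [:: (c, i); (c', i)] 0.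
  have [_ /(_ _ _ cc' c'k (absz (i + N%:Z)%R))] := HW N.
  by rewrite !HN ?inE ?eqxx ?orbT // !(cut_atE (x 0%R)).
move=> c ck.
have win i n : exists2 N, absz i + n <= N &
    forall l, l < n -> g (c, (i + l%:Z)%R) = nth d (W N c) (absz (i + N%:Z)%R + l).
  have [N HN E] := Hg [seq (c, (i + l%:Z)%R) | l <- iota 0 n] (absz i + n).
  exists N => // l ln; rewrite E /f /=; first by congr nth; lia.
  by apply/mapP; exists l; rewrite ?mem_iota.
split=> [i n|i].
  have [N HN E] := win i n.
  have [WL _] := (HW N).1 c ck.
  apply: inLift_infix _ WL.
  have -> : word_at (fun i => g (c, i)) i n = take n (drop (absz (i + N%:Z)%R) (W N c)).
    have sz : size (take n (drop (absz (i + N%:Z)%R) (W N c))) = n.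
      by rewrite size_takel // size_drop sW //; lia.
    apply: (@eq_from_nth _ d) => [|l]; rewrite size_word_at // => ln.
    by rewrite nth_word_at // E // nth_take // nth_drop.
  apply: infix_trans (prefixW (prefix_take _ _)) _.
  by apply: suffixW; rewrite -{2}(cat_take_drop (absz (i + N%:Z)%R) (W N c)) suffix_suffix.
have [N HN E] := win i 1; have := E 0 isT.
rewrite GRing.addr0 addn0 => ->; have [_ Ew] := (HW N).1 c ck.
rewrite -(nth_map d (x 0%R) fst) ?sW //; last by lia.
by rewrite Ew nth_word_at; [congr x|]; lia.
Qed.

(* Take the largest [k] for which every word of the language has [k] lifts with
   pairwise disjoint cuts. If some lift of [x] shared no cut with [k] disjoint
   lifts of [y] on the common tail, then, by recurrence, every word would have
   [k + 1] of them. *)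
Lemma common_cut x y : inX tau x -> inX tau y ->
  (forall i : int, (0 <= i)%R -> x i = y i) ->
  exists F G (j : nat), [/\ is_lift F x, is_lift G y, (F (Posz j)).2 <> None & (G (Posz j)).2 <> None].
Proof.
move=> xX yX xy; have [k [k0 Hk [u0 u0L nu0]]] := max_multi_lift Htau Hprim.
have [F [HF _]] := multi_lift_seq xX Hk; have [G [HG dG]] := multi_lift_seq yX Hk.
have [N HN] := inL_recurrent Hprim u0L.
have := HN (word_at x 0%R N) (xX _ _); rewrite size_word_at leqnn => /(_ isT) /word_at_infixP.
case=> p [_]; rewrite GRing.add0r => Ep.
apply: contrapT => H; apply: nu0.
have dF c : c < k -> forall i : nat, (F 0 (Posz i)).2 = None \/ (G c (Posz i)).2 = None.
  move=> ck i; apply: contrapT => /not_orP[n1 n2]; apply: H.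
  by exists (F 0), (G c), i; split=> //; [apply: HF | apply: HG].
have Epy : word_at y (Posz p) (size u0) = u0.
  by rewrite -{2}Ep; apply: eq_word_at => l _; rewrite xy.
pose W c := word_at (if c is c'.+1 then G c' else F 0) (Posz p) (size u0).
exists W; split.
  case=> [_|c /= ck].
    by split; [apply: (HF 0 k0).1 | rewrite (fst_word_at _ _ (HF 0 k0))].
  by split; [apply: (HG c ck).1 | rewrite (fst_word_at _ _ (HG c ck))].
move=> c [|c'] // cc' c'k i.
case: (ltnP i (size u0)) => iu; last by left; rewrite cut_at_oversize // size_word_at.
rewrite !cut_at_word_at //; case: c cc' => [|c] cc'; first exact: dF.
exact: dG.
Qed.

(** Up to a shift, [x] is the image of [x'] under [tau]; [c i] is the position in [x] where the
    block of [x' i] begins. *)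
Definition desub x' x (c : int -> int) : Prop := forall i : int,
  (c (i + 1) = c i + (size (tau (x' i)))%:Z)%R /\
  word_at x (c i) (size (tau (x' i))) = tau (x' i).

Lemma cut_split F x (j : int) N : is_lift F x -> (F j).2 <> None ->
  exists l r, [/\ size l = N, size r = N, inL tau (l ++ r) &
    word_at x (j - (size (subst tau l))%:Z)%R (size (subst tau (l ++ r))) = subst tau (l ++ r)].
Proof.
(* Radius [N * S] forces at least [N] letters of the preimage on each side of the cut, and the
   images of [N] letters on either side still fit in the window. *)
move=> HF cj; pose M := N * S.
have [u uL] := HF.1 (j - M%:Z)%R (M + M).+1.
case/infix_lift_catP=> L [R E].
have cM : cut_at (lift_word tau u) (size L + M) <> None.
  rewrite E cut_at_infix ?size_word_at; last by lia.
  rewrite cut_at_word_at; last by lia.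
  by rewrite GRing.subrK.
have [u1 [u2 [Eu s1]]] := cut_at_liftP Htau cM.
have [_ [a0 _]] := Hprim; have S0 := maxlen_gt0 Htau a0.
have := congr1 size E; rewrite size_lift // !size_cat size_word_at Eu subst_cat size_cat s1 => s2.
have h1 : N <= size u1.
  by have := size_subst_le tau u1; rewrite s1 mulnC => h; rewrite -(leq_pmul2r S0) -/M; lia.
have h2 : N <= size u2.
  by have := size_subst_le tau u2; rewrite mulnC => h; rewrite -(leq_pmul2r S0) -/M; lia.
have [v1 [l [El sl]]] : exists v1 l, u1 = v1 ++ l /\ size l = N.
  exists (take (size u1 - N) u1), (drop (size u1 - N) u1).
  by rewrite cat_take_drop size_drop subKn.
have [r [v2 [Er sr]]] : exists r v2, u2 = r ++ v2 /\ size r = N.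
  by exists (take N u2), (drop N u2); rewrite cat_take_drop size_takel.
subst u1 u2.
have tl : size (subst tau l) <= M by have := size_subst_le tau l; rewrite sl mulnC.
have tr : size (subst tau r) <= M by have := size_subst_le tau r; rewrite sr mulnC.
exists l, r; split=> //.
  by apply: inL_infix uL; rewrite Eu; apply/infixP; exists v1, v2; rewrite -!catA.
have [||l' [r' [Ex sl']]] := @word_at_subwin _ x (j - M%:Z)%R (M + M).+1
    (j - (size (subst tau l))%:Z)%R (size (subst tau (l ++ r))).
- by lia.
- by rewrite subst_cat size_cat; lia.
move: (congr1 (map fst) E); rewrite lift_fst // !map_cat (fst_word_at _ _ HF) Ex Eu.
have sv1 : size (subst tau v1) = size (map fst L ++ l').
  by rewrite size_cat size_map sl'; move: s1; rewrite subst_cat size_cat; lia.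
rewrite !subst_cat => /eqP; rewrite -!catA [X in _ == X]catA eqseq_cat; last exact: sv1.
case/andP=> _; rewrite [X in X == _]catA eqseq_cat ?size_word_at ?size_cat //.
by case/andP=> /eqP <-.
Qed.

(** The finite desubstitutions from [cut_split], all centred at the same cut [j], have a limit by
    compactness; it is indexed so that the letter at 0 is the first one to the right of the cut. *)
Lemma desub_exists F x (j : int) : is_lift F x -> (F j).2 <> None ->
  exists x' c, [/\ inX tau x', desub x' x c & c 0%R = j].
Proof.
move=> HF cj.
have /choice[l /choice[r Hlr]] N := cut_split N HF cj.
pose d := x 0%R.
pose f N (i : int) := nth d (l N ++ r N) (absz (i + N%:Z)%R).
have [x' Hx'] := fun_compact d f.
have fl N : word_at (f N) (- N%:Z)%R N = l N.
  have [sl sr _ _] := Hlr N.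
  apply: (@eq_from_nth _ d) => [|i]; rewrite size_word_at // => iN.
  rewrite nth_word_at // /f (_ : absz _ = i); last by lia.
  by rewrite nth_cat sl iN.
have fr N : word_at (f N) 0%R N = r N.
  have [sl sr _ _] := Hlr N.
  apply: (@eq_from_nth _ d) => [|i]; rewrite size_word_at // => iN.
  rewrite nth_word_at // /f (_ : absz _ = N + i); last by lia.
  by rewrite nth_cat sl ltnNge leq_addr addKn.
pose lx M := word_at x' (- M%:Z)%R M; pose rx M := word_at x' 0%R M.
have K M : inL tau (lx M ++ rx M) /\
    word_at x (j - (size (subst tau (lx M)))%:Z)%R (size (subst tau (lx M ++ rx M)))
      = subst tau (lx M ++ rx M).
  have [N MN HN] := Hx' [seq (- M%:Z + i%:Z)%R | i <- iota 0 (M + M)] M.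
  have xf i : i < M + M -> x' (- M%:Z + i%:Z)%R = f N (- M%:Z + i%:Z)%R.
    by move=> iM; apply: HN; apply/mapP; exists i; rewrite ?mem_iota.
  have [_ _ lrL Ex] := Hlr N.
  have El : l N = word_at (f N) (- N%:Z)%R (N - M) ++ lx M.
    rewrite -fl -[X in word_at _ _ X = _](subnK MN) word_at_cat; congr (_ ++ _).
    rewrite (_ : (- N%:Z + (N - M)%:Z)%R = (- M%:Z)%R); last by lia.
    by apply: eq_word_at => i iM; rewrite xf //; lia.
  have Er : r N = rx M ++ word_at (f N) M%:Z%R (N - M).
    rewrite -fr -[X in word_at _ _ X = _](subnKC MN) word_at_cat GRing.add0r; congr (_ ++ _).
    apply: eq_word_at => i iM; have := xf (M + i).
    by rewrite (_ : (- M%:Z + (M + i)%:Z)%R = (0 + i%:Z)%R); [move=> -> //; lia | lia].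
  have Elr : l N ++ r N =
      word_at (f N) (- N%:Z)%R (N - M) ++ (lx M ++ rx M) ++ word_at (f N) M%:Z%R (N - M).
    by rewrite El Er -!catA.
  split.
    by apply: inL_infix lrL; rewrite Elr; apply/infixP; do 2!eexists.
  rewrite Elr subst_cat (subst_cat _ (lx M ++ _)) in Ex.
  move/word_at_sub: Ex => Ex; rewrite -[RHS]Ex; congr word_at.
  by rewrite El subst_cat size_cat; lia.
(* Block lengths are summed away from [c 0 = j]: forward over [rx], backward over [lx]. *)
pose c (i : int) : int := if (0 <= i)%R
  then (j + (size (subst tau (rx (absz i))))%:Z)%R
  else (j - (size (subst tau (lx (absz i))))%:Z)%R.
have cN n : c (- n%:Z)%R = (j - (size (subst tau (lx n)))%:Z)%R.
  case: n => [|n]; first by rewrite /c /= /rx /lx /=; lia.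
  have /negbTE h : ~~ (0 <= - n.+1%:Z)%R by lia.
  by rewrite /c h abszN.
have cP (n : nat) : c n%:Z%R = (j + (size (subst tau (rx n)))%:Z)%R by [].
exists x', c; split.
- move=> i n; have [KL _] := K (absz i + n); apply: inL_infix _ KL.
  rewrite /lx /rx -[X in _ ++ word_at _ X _](GRing.addNr (absz i + n)%:Z%R) -word_at_cat.
  by apply: infix_word_at; lia.
- move=> i; case: i => n.
    have Er : rx n.+1 = rx n ++ [:: x' n] by rewrite /rx word_atSr GRing.add0r cats1.
    have -> : (Posz n + 1)%R = Posz n.+1 by lia.
    rewrite !cP Er subst_cat subst1 size_cat; split; first by lia.
    have [_] := K n.+1; rewrite Er !subst_cat subst1 catA => Ex.
    have := @word_at_sub _ x _ _ (tau (x' n)) [::]; rewrite cats0 => /(_ _ _ Ex).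
    by rewrite size_cat => Ex'; rewrite -[RHS]Ex'; congr word_at; lia.
  have El : lx n.+1 = x' (Negz n) :: lx n.
    by rewrite /lx word_atS; congr (x' _ :: word_at _ _ _); lia.
  have -> : (Negz n + 1)%R = (- n%:Z)%R by lia.
  have -> : c (Negz n) = c (- n.+1%:Z)%R by congr c; lia.
  rewrite !cN El subst_cons size_cat; split; first by lia.
  have [_] := K n.+1; rewrite El cat_cons !subst_cons.
  move/(@word_at_sub _ x _ [::]) => Ex; rewrite -[RHS]Ex; congr word_at.
  by rewrite size_cat GRing.addr0.
by have := cP 0; rewrite /rx /= GRing.addr0.
Qed.

Lemma desub_word x' x c : desub x' x c -> forall (i : int) n,
  c (i + n%:Z)%R = (c i + (size (subst tau (word_at x' i n)))%:Z)%R /\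
  word_at x (c i) (size (subst tau (word_at x' i n))) = subst tau (word_at x' i n).
Proof.
move=> D i; elim=> [|n [IH1 IH2]]; first by rewrite /= !GRing.addr0.
rewrite word_atSr -cats1 subst_cat subst1 size_cat word_at_cat IH2 -IH1.
have [E1 ->] := D (i + n%:Z)%R; split=> //.
by rewrite (_ : (i + n.+1%:Z)%R = (i + n%:Z + 1)%R) ?E1 ?IH1; lia.
Qed.

Definition right_asymptotic x y : Prop :=
  [/\ inX tau x, inX tau y, x (-1)%R <> y (-1)%R & forall i : int, (0 <= i)%R -> x i = y i].

(** At a first disagreement [i], the images of the two length-[k] words from [i] start at the same
    cut and lie in the common tail. One is then a prefix of the other, against the left segregating
    bound. *)
Lemma desub_asymptotic k x y x' y' c c' : left_seg tau k ->
  inX tau x' -> inX tau y' -> (forall i : int, (0 <= i)%R -> x i = y i) ->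
  desub x' x c -> desub y' y c' -> (0 <= c 0)%R -> c 0%R = c' 0%R ->
  forall i : int, (0 <= i)%R -> x' i = y' i.
Proof.
move=> [k0 Hk] xX yX xy Dx Dy c0 cc' [i _|//].
have [n le_in] := ubnP i; elim: n i le_in => // n IH i le_in.
have Ew : word_at x' 0%R i = word_at y' 0%R i.
  by apply: eq_word_at => l li; rewrite GRing.add0r; apply: IH; lia.
have [E1 _] := desub_word Dx 0%R i; have [E2 _] := desub_word Dy 0%R i.
rewrite GRing.add0r in E1 E2; rewrite -cc' -Ew -E1 in E2.
apply: contrapT => ne.
have [_ Es] := desub_word Dx i k; have [_ Et] := desub_word Dy i k.
have := Hk (word_at x' i k) (word_at y' i k).
rewrite -Es -Et E2 !size_word_at.
have -> : word_at y (c i) (size (subst tau (word_at y' i k))) =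
    word_at x (c i) (size (subst tau (word_at y' i k))).
  by apply: eq_word_at => l _; rewrite xy //; lia.
rewrite lcp_word_at => H.
have : diff_first (word_at x' i k) (word_at y' i k) by case: (k) k0 => // k' _; rewrite !word_atS.
move/H => H'; have := H' (conj (xX _ _) (size_word_at _ _ _)) (conj (yX _ _) (size_word_at _ _ _)).
by lia.
Qed.

(** The common cut is taken with [j >= 0] minimal. If both preimages had the same letter [a] at -1,
    the start of this block would be a common cut further left; it is either still nonnegative,
    against minimality, or the block covers -1 and forces [x] and [y] to agree there. *)
Lemma right_asymptotic_desub k x y : left_seg tau k -> right_asymptotic x y ->
  exists x' y' c c' (j : nat), [/\ right_asymptotic x' y', desub x' x c, desub y' y c',
    c 0%R = j & c' 0%R = j].
Proof.
move=> Hk [xX yX ne xy].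
pose P (j : nat) := `[< exists x' y' c c', [/\ inX tau x' /\ inX tau y',
  desub x' x c, desub y' y c', c 0%R = j & c' 0%R = j] >].
have exP : exists j, P j.
  have [F [G [j [HF HG Fj Gj]]]] := common_cut xX yX xy.
  have [x' [c [xX' Dx Ec]]] := desub_exists HF Fj.
  have [y' [c' [yX' Dy Ec']]] := desub_exists HG Gj.
  by exists j; apply/asboolP; exists x', y', c, c'.
case: (ex_minnP exP) => j /asboolP[x' [y' [c [c' [[xX' yX'] Dx Dy Ec Ec']]]]] jmin.
exists x', y', c, c', j; split=> //; split=> //; last first.
  by apply: (desub_asymptotic Hk xX' yX' xy Dx Dy); rewrite ?Ec ?Ec'.
move=> E1; have [Cx Wx] := Dx (-1)%R; have [Cy Wy] := Dy (-1)%R.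
rewrite -E1 in Cy Wy; set a := x' (-1)%R in Cx Wx Cy Wy.
rewrite GRing.addNr in Cx Cy; rewrite Ec in Cx; rewrite Ec' in Cy.
have a0 := size_tau_gt0 Htau a.
have Ecc : c (-1)%R = c' (-1)%R by lia.
case: (leqP (size (tau a)) j) => ja; last first.
  apply: ne; rewrite -Ecc -[RHS]Wx in Wy.
  have h' : absz (-1 - c (-1)%R)%R < size (tau a) by lia.
  have := word_at_eq Wy h'.
  by rewrite (_ : (c (-1) + (absz (-1 - c (-1)%R)%R)%:Z)%R = (-1)%R) => [->//|]; last by lia.
have : P (j - size (tau a)).
  apply/asboolP; exists (fun i => x' (i - 1)%R), (fun i => y' (i - 1)%R).
  exists (fun i => c (i - 1)%R), (fun i => c' (i - 1)%R); split.
  - split=> i n; [have := xX' (i - 1)%R n|have := yX' (i - 1)%R n];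
      congr inL; apply: eq_word_at => l _; congr (_ _); lia.
  - by move=> i; have := Dx (i - 1)%R; rewrite GRing.addrAC.
  - by move=> i; have := Dy (i - 1)%R; rewrite GRing.addrAC.
  - by rewrite -[LHS]/(c (-1)%R); lia.
  - by rewrite -[LHS]/(c' (-1)%R); lia.
by move/jmin; lia.
Qed.

End Desubstitution.

(** * Finite stages of the completion of a generator *)

Section Completion.
Variables (A : finType) (tau : A -> seq A).
Hypothesis Htau : forall a, tau a != [::].
Implicit Types (x : int -> A) (v u w : seq A).

Definition left_part v k : seq A := flatten [seq tpow tau (k - i) v | i <- iota 0 k.+1].

(** With [right_wordS] and [tau(u) = vuw], this says that each stage of the completion is the image
    of the previous one. *)
Lemma left_partS v k : left_part v k.+1 = subst tau (left_part v k) ++ v.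
Proof.
rewrite /left_part -[k.+2]addn1 iotaD map_cat flatten_cat /= subnn cats0; congr (_ ++ _).
rewrite -[tpow tau k.+1 v ++ _]/(flatten (map _ (0 :: iota 1 k))) -[_ :: _]/(iota 0 k.+1).
have : forall s, all (fun i => i <= k) s ->
  flatten [seq tpow tau (k.+1 - i) v | i <- s] = subst tau (flatten [seq tpow tau (k - i) v | i <- s]).
  by elim=> //= i s IH /andP[ik /IH->]; rewrite subst_cat subSn.
by apply; apply/allP=> i; rewrite mem_iota.
Qed.

Lemma right_wordS w k : right_word tau w k.+1 = w ++ subst tau (right_word tau w k).
Proof.
rewrite /right_word -[iota 0 k.+2]/(0 :: iota 1 k.+1) /=; congr (_ ++ _).
rewrite -[tpow tau 1 w ++ _]/(flatten (map _ (1 :: iota 2 k))) -[_ :: _]/(iota 1 k.+1).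
rewrite -[w ++ _]/(flatten (map _ (0 :: iota 1 k))) -[0 :: _]/(iota 0 k.+1).
by rewrite (iotaDl 1 0); elim: (iota 0 k.+1) => //= i s ->; rewrite subst_cat.
Qed.

(** The position [p] is where the central [u] begins in [x], the same for all stages [k]. *)
Definition occurs_completed x v u w (p : int) : Prop := forall k,
  word_at x (p - (size (left_part v k))%:Z)%R
    (size (left_part v k ++ u ++ right_word tau w k))
  = left_part v k ++ u ++ right_word tau w k.

(** Each stage gains at least one letter, so the lookups at stage [n] in [completion] are in range
    and never reach the default letter. *)
Lemma size_left_part v k : v != [::] -> k < size (left_part v k).
Proof.
move=> v0; have {}v0 : 0 < size v by rewrite lt0n size_eq0.
elim: k => [|k IH]; first by rewrite /left_part /= cats0.
by rewrite left_partS size_cat; have := size_subst_ge Htau (left_part v k); lia.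
Qed.

Lemma size_right_word w k : w != [::] -> k < size (right_word tau w k).
Proof.
move=> w0; have {}w0 : 0 < size w by rewrite lt0n size_eq0.
elim: k => [|k IH]; first by rewrite /right_word /= cats0.
by rewrite right_wordS size_cat; have := size_subst_ge Htau (right_word tau w k); lia.
Qed.

Lemma occurs_completion x v u w p : is_generator tau v u w -> occurs_completed x v u w p ->
  forall d, shift_equiv (completion tau d v u w) x.
Proof.
(* Index 0 of the completion is the start of [w], hence the shift by [p + |u|]. *)
move=> [v0 [_ [w0 _]]] H d; exists (p + (size u)%:Z)%R => -[n|n] /=.
  have := H n; rewrite catA -[right_word tau w n]cats0 => /word_at_sub; rewrite cats0 => E.
  rewrite -[X in nth d X n]E nth_word_at; last exact: size_right_word.
  by congr x; rewrite size_cat; lia.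
have := H n; rewrite catA -[left_part v n ++ u]cat0s -catA => /word_at_sub.
rewrite /= GRing.addr0 /left_word -/(left_part v n) => E.
have sv := size_left_part n v0.
rewrite -[X in nth d X _]E nth_word_at; last by rewrite size_cat; lia.
by congr x; rewrite size_cat; lia.
Qed.

End Completion.

(** * Asymptotic pairs and the rs graph *)

Section LeftSpecial.
Variables (A : finType) (tau : A -> seq A).
Hypothesis Htau : forall a, tau a != [::].
Hypothesis Hprim : primitive tau.
Implicit Types (x y : int -> A) (s t : seq A).
Local Notation asymptotic := (right_asymptotic tau).
Local Notation before x n := (word_at x (- n%:Z)%R n).

Lemma diff_last_word_at x y (i j : int) m n : 0 < m -> 0 < n ->
  (i + m%:Z = j + n%:Z)%R -> x (i + m%:Z - 1)%R <> y (i + m%:Z - 1)%R ->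
  diff_last (word_at x i m) (word_at y j n).
Proof.
case: m n => [|m] [|n] // _ _ E ne; rewrite !word_atSr /diff_last !rev_rcons /=.
have -> : (i + m%:Z = i + m.+1%:Z - 1)%R by lia.
by have -> : (j + n%:Z = i + m.+1%:Z - 1)%R by lia.
Qed.

(** The images of the last [n] letters both end just before [j]. They agree on [[0, j)] and differ
    at -1, so their longest common suffix has length exactly [j], and deleting it leaves words
    ending at -1. *)
Lemma asymptotic_vertex x y x' y' c c' (j : nat) n :
  right_seg tau n -> asymptotic x y -> asymptotic x' y' ->
  desub tau x' x c -> desub tau y' y c' -> c 0%R = j -> c' 0%R = j ->
  [/\ rs_vertex tau n (before x' n, before y' n),
    j = lcs (subst tau (before x' n)) (subst tau (before y' n)),
    j + n <= size (subst tau (before x' n)) &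
    rs_edge tau n (before x' n, before y' n) = (before x n, before y n)].
Proof.
move=> [n0 Hn] [_ _ ne xy] [xX' yX' ne' _] Dx Dy Ec Ec'.
set s := before x' n; set t := before y' n.
have sL : inLn tau n s by split; [apply: xX' | apply: size_word_at].
have tL : inLn tau n t by split; [apply: yX' | apply: size_word_at].
have dst : diff_last s t.
  by apply: diff_last_word_at; rewrite ?GRing.addNr ?GRing.sub0r.
have [] := desub_word Dx (- n%:Z)%R n; have [] := desub_word Dy (- n%:Z)%R n.
rewrite !GRing.addNr Ec Ec' -/s -/t; set Sx := subst tau s; set T := subst tau t => E1 ET E2 ES.
have {}E1 : c' (- n%:Z)%R = (j%:Z - (size T)%:Z)%R by lia.
have {}E2 : c (- n%:Z)%R = (j%:Z - (size Sx)%:Z)%R by lia.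
rewrite E1 in ET; rewrite E2 in ES.
have := Hn _ _ sL tL dst; rewrite -/Sx -/T => Hlcs.
have Wxy (i : int) m : (0 <= i)%R -> word_at x i m = word_at y i m.
  by move=> i0; apply: eq_word_at => l _; rewrite xy //; lia.
(* Otherwise this image lies in the common tail and is compared with a window of the same sequence,
   so the common suffix is as long as the shorter image, against right segregation. *)
have jS : j < size Sx.
  rewrite ltnNge; apply/negP => Sj; move: Hlcs.
  rewrite -{1}ES -{1}ET Wxy; last by lia.
  by rewrite lcs_word_at; lia.
have jT : j < size T.
  rewrite ltnNge; apply/negP => Tj; move: Hlcs.
  rewrite -{1}ES -{1}ET -Wxy; last by lia.
  by rewrite lcs_word_at; lia.
have DS : Sx = word_at x (j%:Z - (size Sx)%:Z)%R (size Sx - j) ++ word_at x 0%R j.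
  rewrite -[LHS]ES -[X in word_at _ _ X = _](subnK (ltnW jS)) word_at_cat.
  by congr (_ ++ word_at _ _ _); lia.
have DT : T = word_at y (j%:Z - (size T)%:Z)%R (size T - j) ++ word_at x 0%R j.
  rewrite -[LHS]ET -[X in word_at _ _ X = _](subnK (ltnW jT)) word_at_cat Wxy //.
  by congr (_ ++ word_at _ _ _); lia.
have lcsE : lcs Sx T = j.
  rewrite DS DT lcs_diff ?size_word_at //.
  apply: diff_last_word_at; [by lia | by lia | by lia |].
  by have -> : (j%:Z - (size Sx)%:Z + (size Sx - j)%:Z - 1 = -1)%R by lia.
have edge z (Z : seq A) : Z = word_at z (j%:Z - (size Z)%:Z)%R (size Z - j) ++ word_at x 0%R j ->
    j + n <= size Z ->
    let Z' := take (size Z - j) Z in drop (size Z' - n) Z' = before z n.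
  move=> EZ le /=; rewrite EZ; set q := size Z; set i := (_ - _)%R.
  have Et : take (size (word_at z i (q - j) ++ word_at x 0%R j) - j)
      (word_at z i (q - j) ++ word_at x 0%R j) = word_at z i (q - j).
    by rewrite size_cat !size_word_at addnK take_size_cat ?size_word_at.
  rewrite Et size_word_at.
  have -> : word_at z i (q - j) = word_at z i (q - j - n) ++ before z n.
    have E : q - j = (q - j - n) + n by lia.
    by rewrite {1}E word_at_cat; congr (_ ++ word_at _ _ _); lia.
  by rewrite drop_size_cat ?size_word_at.
split=> //; first by lia.
rewrite /rs_edge /= -/Sx -/T lcsE; congr (_, _); apply: edge => //; lia.
Qed.

(** * Fixed windows and the construction of the generator *)

Section Fixed.
Variables (k n : nat).
Hypotheses (Hk : left_seg tau k) (Hn : least_right_seg tau n).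
Hypotheses (Hll : ll_subfixed tau) (Hrl : rl_subfixed tau) (Hrs : rs_subfixed tau).

(* Every asymptotic pair has a desubstitution, so every vertex read off such a
   pair is in the image of [rs_edge], and is therefore fixed. *)
Lemma asymptotic_fixed x y : asymptotic x y ->
  exists x' y' c (j : nat), [/\ asymptotic x' y' /\ desub tau x' x c, c 0%R = j,
    j = lcs (subst tau (before x n)) (subst tau (before y n)),
    j + n <= size (subst tau (before x n)) &
    before x' n = before x n /\ before y' n = before y n].
Proof.
move=> xy; have [nseg _] := Hn.
have [x1 [y1 [c1 [c1' [j1 [xy1 Dx1 Dy1 Ec1 Ec1']]]]]] := right_asymptotic_desub Htau Hprim Hk xy.
have [x2 [y2 [c2 [c2' [j2 [xy2 Dx2 Dy2 Ec2 Ec2']]]]]] := right_asymptotic_desub Htau Hprim Hk xy1.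
have [V1 E1 l1 e1] := asymptotic_vertex nseg xy xy1 Dx1 Dy1 Ec1 Ec1'.
have [V2 _ _ e2] := asymptotic_vertex nseg xy1 xy2 Dx2 Dy2 Ec2 Ec2'.
have : rs_edge tau n (before x1 n, before y1 n) = (before x1 n, before y1 n).
  by case: (Hrs Hn V2); rewrite e2 // => E; rewrite {1}E e2.
rewrite e1 => -[Ex Ey]; exists x1, y1, c1, j1.
by rewrite Ex Ey.
Qed.

Lemma ll_edge_desub x' x c (i : int) : desub tau x' x c -> ll_edge tau (x' i) = x (c i).
Proof.
by move=> D; have [_] := D i; rewrite /ll_edge; case: (tau _) (Htau (x' i)) => //= a r _; rewrite word_atS => -[->].
Qed.

Lemma rl_edge_desub x' x c (i : int) : desub tau x' x c ->
  rl_edge tau (x' i) = x (c (i + 1) - 1)%R.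
Proof.
move=> D; have [-> ] := D i; rewrite /rl_edge.
case/lastP: (tau _) (Htau (x' i)) => //= r a _; rewrite last_rcons size_rcons word_atSr.
by move/rcons_inj=> [_ <-]; congr x; lia.
Qed.

(** The fixed vertex determines [j], so two successive desubstitutions place the image of the fixed
    word identically. If that image covers 0 or [-n-1], the letter there is read from it; if not, a
    block starts at 0 or ends at [-n-1], and the ll or rl graph fixes the letter. *)
Lemma asymptotic_window x y : asymptotic x y ->
  exists x' y' c (j : nat), [/\ asymptotic x' y' /\ desub tau x' x c, c 0%R = j,
    j = lcs (subst tau (before x n)) (subst tau (before y n)),
    j + n <= size (subst tau (before x n)) &
    word_at x' (- n%:Z - 1)%R n.+2 = word_at x (- n%:Z - 1)%R n.+2
    /\ before y' n = before y n].
Proof.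
move=> xy; have [x1 [y1 [c1 [j1 [[xy1 D1] Ec1 Ej1 le1 [Ex1 Ey1]]]]]] := asymptotic_fixed xy.
have [x2 [y2 [c2 [j2 [[xy2 D2] Ec2 Ej2 le2 [Ex2 Ey2]]]]]] := asymptotic_fixed xy1.
rewrite Ex1 Ey1 -Ej1 in Ej2; subst j2.
have [C1 W1] := desub_word D1 (- n%:Z)%R n; have [C2 W2] := desub_word D2 (- n%:Z)%R n.
rewrite !GRing.addNr Ec1 Ec2 Ex2 Ex1 in C1 W1 C2 W2.
have Ecc : c2 (- n%:Z)%R = c1 (- n%:Z)%R by lia.
rewrite Ecc -[RHS]W1 in W2.
have E0 : x1 0%R = x 0%R.
  case: (posnP j1) => j0; last first.
    have lt : size (subst tau (before x n)) - j1 < size (subst tau (before x n)) by lia.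
    have := word_at_eq W2 lt.
    by have -> : (c1 (- n%:Z) + (size (subst tau (before x n)) - j1)%:Z = 0)%R by lia.
  have e1 := ll_edge_desub 0%R D1; have e2 := ll_edge_desub 0%R D2.
  rewrite Ec1 j0 in e1; rewrite Ec2 j0 in e2; rewrite -e1 -e2.
  by case: (Hll (x := x2 0%R) I) => E; rewrite !E.
have E1 : x1 (- n%:Z - 1)%R = x (- n%:Z - 1)%R.
  case: (ltngtP (j1 + n) (size (subst tau (before x n)))) le1 => // [lt _|Es _].
    have lt' : size (subst tau (before x n)) - j1 - n - 1 < size (subst tau (before x n)) by lia.
    have := word_at_eq W2 lt'.
    by have -> : (c1 (- n%:Z) + (size (subst tau (before x n)) - j1 - n - 1)%:Z = - n%:Z - 1)%R by lia.
  have e1 := rl_edge_desub (- n%:Z - 1)%R D1; have e2 := rl_edge_desub (- n%:Z - 1)%R D2.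
  rewrite GRing.subrK (_ : c1 _ = - n%:Z)%R in e1; last by lia.
  rewrite GRing.subrK (_ : c2 _ = - n%:Z)%R in e2; last by lia.
  by rewrite -e1 -e2; case: (Hrl (x := x2 (- n%:Z - 1)%R) I) => E; rewrite !E.
exists x1, y1, c1, j1; split=> //; split=> //.
by rewrite !(word_atS _ _ n.+1) E1 GRing.subrK !word_atSr !GRing.addNr E0 Ex1.
Qed.

Lemma asymptotic_generator x y : asymptotic x y ->
  exists v u w p, is_generator tau v u w /\ occurs_completed tau x v u w p.
Proof.
move=> xy; pose p := (- n%:Z - 1)%R : int; pose u := word_at x p n.+2.
have pE : p = (- n%:Z - 1)%R by [].
have [x1 [y1 [c1 [j [[xy1 D1] Ec1 Ej le1 [Eu _]]]]]] := asymptotic_window xy.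
have [Cp Wp] := desub_word D1 p n.+1; have [C1 _] := D1 0%R.
have [Cu Wu] := desub_word D1 p n.+2; have [Ca Wa] := D1 p.
rewrite Eu -/u in Cu Wu.
have Ep1 : word_at x1 p n.+1 = word_at x p n.+1.
  by move/eqP: Eu; rewrite !word_atSr eqseq_rcons -/p -!word_atSr => /andP[/eqP].
have Ex0 : x1 0%R = x 0%R.
  have lt : n.+1 < n.+2 by [].
  by have := word_at_eq Eu lt; have -> : (- n%:Z - 1 + n.+1%:Z = 0)%R by lia.
have Exp : x1 p = x p by have := word_at_eq Eu (ltn0Sn _); rewrite !GRing.addr0.
have cn : c1 (- n%:Z)%R = (j%:Z - (size (subst tau (before x n)))%:Z)%R.
  have [] := desub_word D1 (- n%:Z)%R n; rewrite GRing.addNr Ec1.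
  have -> : before x1 n = before x n; last by lia.
  by move/eqP: Ep1; rewrite !word_atS GRing.subrK eqseq_cons => /andP[_ /eqP].
rewrite Ep1 (_ : (p + n.+1%:Z)%R = 0%R) ?Ec1 in Cp; last by lia.
rewrite (_ : (p + n.+2%:Z)%R = (0 + 1)%R) ?C1 ?Ec1 in Cu; last by lia.
(* The image of the [n] letters before 0 starts at or before [-n], so [c1 p <= p]; equality would
   give [tau(a) = a] for the letter at [p]. The right end is treated likewise. *)
have lev : (c1 p < p)%R.
  rewrite GRing.subrK cn in Ca.
  have a0 := size_tau_gt0 Htau (x1 p).
  have [//|h] := Order.TotalTheory.ltP (c1 p) p.
  have s1 : size (tau (x1 p)) = 1 by lia.
  have cpE : c1 p = p by lia.
  rewrite s1 word_at1 cpE Exp in Wa.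
  by case: (tau_neq_letter Hprim (esym Wa)).
have lew : (1 < c1 (0 + 1))%R.
  rewrite C1 Ec1; have b0 := size_tau_gt0 Htau (x1 0%R).
  have [//|h] := Order.TotalTheory.ltP 1%R (j%:Z + (size (tau (x1 0%R)))%:Z)%R.
  have [_] := D1 0%R; have -> : size (tau (x1 0%R)) = 1 by lia.
  rewrite Ec1 (_ : j = 0) ?word_at1 ?Ex0; last by lia.
  by move/esym/(tau_neq_letter Hprim).
pose v := word_at x (c1 p) (absz (p - c1 p)%R).
pose w := word_at x 1%R (absz (c1 (0 + 1)%R - 1)%R).
have Esub : subst tau u = v ++ u ++ w.
  rewrite -Wu (_ : size _ = absz (p - c1 p)%R + (n.+2 + absz (c1 (0 + 1)%R - 1)%R)).
    by rewrite !word_at_cat; congr (_ ++ (word_at _ _ _ ++ word_at _ _ _)); lia.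
  by rewrite C1 Ec1 in lew *; lia.
have xX : inX tau x by case: xy.
exists v, u, w, p; split.
  split; first by rewrite -size_eq0 size_word_at; lia.
  split; first by rewrite -size_eq0 size_word_at.
  by split; first (by rewrite -size_eq0 size_word_at; lia); split; first exact: xX.
(* The statement ranges over all pairs with the same [u] and the same [before y n], since the
   hypothesis is applied to a preimage pair. Both words together determine [j], hence where the
   image of [u] lies relative to [p]. *)
have step L R :
    (forall x' y', asymptotic x' y' -> word_at x' p n.+2 = u -> before y' n = before y n ->
      word_at x' (p - (size L)%:Z)%R (size (L ++ u ++ R)) = L ++ u ++ R) ->
    forall x' y', asymptotic x' y' -> word_at x' p n.+2 = u -> before y' n = before y n ->
      word_at x' (p - (size (subst tau L ++ v))%:Z)%R
        (size ((subst tau L ++ v) ++ u ++ (w ++ subst tau R)))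
      = (subst tau L ++ v) ++ u ++ (w ++ subst tau R).
  move=> IH x' y' xy' Eu' Ey'.
  have bu z : word_at z p n.+2 = u -> before z n = before x n /\ word_at z p n.+1 = word_at x p n.+1.
    move/eqP; rewrite /u !(word_atSr _ _ n.+1) eqseq_rcons => /andP[/eqP E _]; split=> //.
    by move/eqP: E; rewrite !word_atS GRing.subrK eqseq_cons => /andP[_ /eqP].
  have [x2 [y2 [c2 [j2 [[xy2 D2] Ec2 Ej2 _ [Eu2 Ey2]]]]]] := asymptotic_window xy'.
  rewrite -/p Eu' in Eu2; rewrite Ey' in Ey2.
  have {}IH := IH x2 y2 xy2 Eu2 Ey2.
  rewrite (bu _ Eu').1 Ey' -Ej in Ej2; subst j2.
  have [Cp2 _] := desub_word D2 p n.+1.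
  rewrite (bu _ Eu2).2 (_ : (p + n.+1%:Z)%R = 0%R) ?Ec2 in Cp2; last by lia.
  have [CL _] := desub_word D2 (p - (size L)%:Z)%R (size L).
  have [_ WL] := desub_word D2 (p - (size L)%:Z)%R (size (L ++ u ++ R)).
  have EL : word_at x2 (p - (size L)%:Z)%R (size L) = L.
    have := @word_at_sub _ x2 (p - (size L)%:Z)%R [::] L (u ++ R); rewrite GRing.addr0; exact.
  have Z : subst tau (L ++ u ++ R) = (subst tau L ++ v) ++ u ++ w ++ subst tau R.
    by rewrite !subst_cat Esub -!catA.
  rewrite EL GRing.subrK in CL; rewrite IH Z in WL; rewrite -[RHS]WL; congr word_at.
  rewrite size_cat size_word_at; lia.
suff H m : forall x' y', asymptotic x' y' -> word_at x' p n.+2 = u -> before y' n = before y n ->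
    word_at x' (p - (size (left_part tau v m))%:Z)%R
      (size (left_part tau v m ++ u ++ right_word tau w m)) =
    left_part tau v m ++ u ++ right_word tau w m by move=> m; apply: H xy _ _.
elim: m => [|m IH]; last by rewrite left_partS right_wordS; apply: step IH.
have -> : left_part tau v 0 = v by rewrite /left_part /= cats0.
have -> : right_word tau w 0 = w by rewrite /right_word /= cats0.
(* Stage 0 is itself one [step], from the bare occurrence of [u]. *)
have := step [::] [::]; rewrite -[subst tau [::]]/(@nil A) !cats0; apply.
move=> x' y' _ Eu' _; rewrite GRing.subr0 -[RHS]Eu'.
by rewrite -[[::] ++ u]/(word_at x p n.+2) size_word_at.
Qed.

End Fixed.

Lemma least_right_seg_exists k : right_seg tau k -> exists n, least_right_seg tau n.
Proof.
move=> Hk; have exP : exists n, `[< right_seg tau n >] by exists k; apply/asboolP.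
case: (ex_minnP exP) => n /asboolP Hn Hmin; exists n; split=> // m Hm.
by apply: Hmin; apply/asboolP.
Qed.

Lemma left_special_generator x : segregating tau ->
  ll_subfixed tau -> rl_subfixed tau -> rs_subfixed tau ->
  inX tau x -> left_special tau x ->
  exists v u w p, is_generator tau v u w /\ occurs_completed tau x v u w p.
Proof.
move=> [[k Hk] [m Hm]] Hll Hrl Hrs xX [y [yX [ne xy]]].
have [n Hn] := least_right_seg_exists Hm.
exact: (asymptotic_generator Hk Hn Hll Hrl Hrs (And4 xX yX ne xy)).
Qed.

End LeftSpecial.

(** * Reversal, exchanging left and right *)

Section Reversal.
Variables (A : finType) (tau : A -> seq A).
Implicit Types (x : int -> A) (s t u v w : seq A).

Definition rev_tau (a : A) : seq A := rev (tau a).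
(** The reflection [i -> -1 - i] swaps -1 and 0, matching the two conventions for special
    sequences. *)
Definition rev_seq x (i : int) : A := x (- 1 - i)%R.

Lemma subst_rev s : subst rev_tau s = rev (subst tau (rev s)).
Proof.
elim: s => // a s IH; rewrite subst_cons IH rev_cons -cats1 subst_cat subst1.
by rewrite rev_cat.
Qed.

Lemma tpow_rev k s : tpow rev_tau k s = rev (tpow tau k (rev s)).
Proof.
by elim: k => [|k IH]; rewrite ?tpowS ?IH ?subst_rev !revK.
Qed.

Lemma inL_rev u : inL rev_tau u <-> inL tau (rev u).
Proof.
by split=> -[a [m [m1 H]]]; exists a, m; split=> //; move: H;
  rewrite tpow_rev -infix_rev ?revK.
Qed.

Lemma inLn_rev n u : inLn rev_tau n u <-> inLn tau n (rev u).
Proof. by rewrite /inLn size_rev; split=> -[H E]; split=> //; apply/inL_rev. Qed.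

Lemma word_at_rev_seq x (i : int) n :
  word_at (rev_seq x) i n = rev (word_at x (- i - n%:Z)%R n).
Proof.
apply: (@eq_from_nth _ (x 0%R)); rewrite ?size_rev !size_word_at // => k kn.
rewrite nth_rev ?size_word_at // !nth_word_at //; last by lia.
by rewrite /rev_seq; congr x; lia.
Qed.

Lemma inX_rev x : inX tau x -> inX rev_tau (rev_seq x).
Proof. by move=> xX i n; apply/inL_rev; rewrite word_at_rev_seq revK. Qed.

Lemma primitive_rev : primitive tau -> primitive rev_tau.
Proof.
move=> [[m [m1 Hm]] [a Ha]]; split.
  by exists m; split=> // b c; rewrite tpow_rev mem_rev; apply: Hm.
by exists a => N; have [k Hk] := Ha N; exists k; rewrite tpow_rev size_rev; apply: Hk.
Qed.

Lemma right_seg_rev k : right_seg rev_tau k <-> left_seg tau k.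
Proof.
split=> -[k0 H]; split=> // s t sL tL d.
  have := H (rev s) (rev t); rewrite /lcs /diff_last !subst_rev !revK !size_rev.
  by apply=> //; apply/inLn_rev; rewrite revK.
rewrite !subst_rev !size_rev /lcs !revK; apply: H => //; exact/inLn_rev.
Qed.

Lemma left_seg_rev k : right_seg tau k -> left_seg rev_tau k.
Proof.
move=> [k0 H]; split=> // s t sL tL d; have := H (rev s) (rev t).
rewrite /lcs /diff_last !revK !subst_rev !size_rev; apply=> //; exact/inLn_rev.
Qed.

Lemma segregating_rev : segregating tau -> segregating rev_tau.
Proof.
move=> [[k Hk] [m Hm]]; split; first by exists m; apply: left_seg_rev.
by exists k; apply/right_seg_rev.
Qed.

Lemma ll_subfixed_rev : rl_subfixed tau -> ll_subfixed rev_tau.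
Proof.
have E a : ll_edge rev_tau a = rl_edge tau a.
  rewrite /ll_edge /rl_edge /rev_tau; case/lastP: (tau a) => //= r b.
  by rewrite rev_rcons last_rcons.
by move=> H a _; rewrite !E; apply: H.
Qed.

Lemma rl_subfixed_rev : ll_subfixed tau -> rl_subfixed rev_tau.
Proof.
have E a : rl_edge rev_tau a = ll_edge tau a.
  rewrite /ll_edge /rl_edge /rev_tau; case: (tau a) => //= b r.
  by rewrite rev_cons last_rcons.
by move=> H a _; rewrite !E; apply: H.
Qed.

Lemma rs_edge_rev n s t : rs_edge rev_tau n (rev s, rev t) =
  (rev (ls_edge tau n (s, t)).1, rev (ls_edge tau n (s, t)).2).
Proof.
have E q z : let z' := take (size (rev z) - q) (rev z) in
    drop (size z' - n) z' = rev (take n (drop q z)) :> seq A.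
  by rewrite /= size_rev -rev_drop size_rev -rev_take.
by rewrite /rs_edge /ls_edge /= !subst_rev !revK /lcs !revK !E.
Qed.

Lemma rs_subfixed_rev : ls_subfixed tau -> rs_subfixed rev_tau.
Proof.
move=> H n [Hn Hmin].
have {}H : subfixed_fun (ls_vertex tau n) (ls_edge tau n).
  by apply: H; split=> [|k Hk]; [apply/right_seg_rev | apply/Hmin/right_seg_rev].
case=> s t [/= sL [tL d]].
have := H (rev s, rev t); case.
- by split; [apply/inLn_rev | split; [apply/inLn_rev|]].
- move=> E; left; rewrite -[s]revK -[t]revK rs_edge_rev E //.
- move=> E; right; rewrite -[s]revK -[t]revK rs_edge_rev rs_edge_rev.
  by rewrite -surjective_pairing E.
Qed.

Lemma left_part_rev v k : left_part rev_tau v k = rev (right_word tau (rev v) k).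
Proof.
elim: k => [|k IH]; first by rewrite /left_part /right_word /= !cats0 revK.
by rewrite left_partS IH right_wordS subst_rev rev_cat !revK.
Qed.

Lemma right_word_rev w k : right_word rev_tau w k = rev (left_part tau (rev w) k).
Proof.
elim: k => [|k IH]; first by rewrite /left_part /right_word /= !cats0 revK.
by rewrite right_wordS IH left_partS subst_rev rev_cat !revK.
Qed.

Lemma is_generator_rev v u w :
  is_generator rev_tau v u w -> is_generator tau (rev w) (rev u) (rev v).
Proof.
have nz z : z != [::] -> rev z != [::] by rewrite -!size_eq0 size_rev.
move=> [/nz v0 [/nz u0 [/nz w0 [/inL_rev uL E]]]]; do 4!split=> //.
by move/(congr1 rev): E; rewrite subst_rev revK !rev_cat catA.
Qed.

(** The reflection carries the positions [[p, p + |u|)] of [u] to [[-p - |u|, -p)]. *)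
Lemma occurs_completed_rev x v u w p :
  occurs_completed rev_tau (rev_seq x) v u w p ->
  occurs_completed tau x (rev w) (rev u) (rev v) (- p - (size u)%:Z)%R.
Proof.
move=> H k; have /(congr1 rev) := H k.
rewrite left_part_rev right_word_rev word_at_rev_seq revK !rev_cat !revK -(catA (left_part _ _ _)) => E.
rewrite -[RHS]E; congr word_at; rewrite !size_cat !size_rev; lia.
Qed.

Lemma left_special_rev x : right_special tau x -> left_special rev_tau (rev_seq x).
Proof.
move=> [y [yX [ne xy]]]; exists (rev_seq y); split; first exact: inX_rev.
by split=> // i i0; apply: xy; lia.
Qed.

End Reversal.

Theorem mainTheorem9 (A : finType) (tau : A -> seq A)
  (Htau : forall a : A, tau a != [::])
  (Hprim : primitive tau) (Haper : aperiodic tau) (Hseg : segregating tau)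
  (Hll : ll_subfixed tau) (Hrl : rl_subfixed tau)
  (Hls : ls_subfixed tau) (Hrs : rs_subfixed tau) :
  forall x : int -> A, inX tau x -> (left_special tau x \/ right_special tau x) ->
  exists v u w : seq A, is_generator tau v u w /\
    forall d : A, shift_equiv (completion tau d v u w) x.
Proof.
move=> x xX [xl | xr].
  have [v [u [w [p [G O]]]]] := left_special_generator Htau Hprim Hseg Hll Hrl Hrs xX xl.
  by exists v, u, w; split=> //; apply: occurs_completion O.
(* The right special case is the left special one for [rev_tau], whose rs graph is the reversed ls
   graph of [tau]; reversing back turns [(v, u, w)] into [(rev w, rev u, rev v)]. *)
have Htau' a : rev_tau tau a != [::] by rewrite -size_eq0 size_rev size_eq0.
have [v [u [w [p [G O]]]]] := left_special_generator Htau' (primitive_rev Hprim)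
  (segregating_rev Hseg) (ll_subfixed_rev Hrl) (rl_subfixed_rev Hll)
  (rs_subfixed_rev Hls) (inX_rev xX) (left_special_rev xr).
have {}G := is_generator_rev G.
by exists (rev w), (rev u), (rev v); split=> //; apply: occurs_completion (occurs_completed_rev O).
Qed.
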